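(* Let $n\ge1$ and let $\mathfrak{P}_0$ be a convex subset of the set $\mathfrak{P}_n$ of all $n$-variate probability distributions $\bar p=\{p_{i_1\dots i_n}\}_{(i_1,\dots,i_n)\in\mathbb{N}_0^n}$; let $\widetilde{\mathfrak{P}}_0$ be the cone generated by $\mathfrak{P}_0$. Let $a_f,b_f$ be continuous functions on $[0,1]$ with $a_f(0)=b_f(0)=0$, $a_f(\lambda)=a_f(1-\lambda)$, $b_f(\lambda)=b_f(1-\lambda)$ for all $\lambda\in[0,1]$, both concave and non-decreasing on $[0,\frac12]$. Let $f:\mathfrak{P}_0\to[0,+\infty]$ satisfy $$f(\lambda\bar x+(1-\lambda)\bar y)\ge\lambda f(\bar x)+(1-\lambda)f(\bar y)-a_f(\lambda),\qquad f(\lambda\bar x+(1-\lambda)\bar y)\le\lambda f(\bar x)+(1-\lambda)f(\bar y)+b_f(\lambda)$$ for all $\bar x,\bar y\in\mathfrak{P}_0$ and $\lambda\in[0,1]$ (with possible values $+\infty$ on both sides). Let $\tilde f$ be the homogeneous extension of $f$ to $\widetilde{\mathfrak{P}}_0$. Let $\bar p=\{p_{i_1\dots i_n}\}\in\mathfrak{P}_0$ be such that (a) $h(\bar p)=\{h(p_{i_1\dots i_n})\}\in\widetilde{\mathfrak{P}}_0$ for any function $h:\mathbb{R}_+\to\mathbb{R}_+$ with $h(x)\le x$ for all $x\in\mathbb{R}_+$; (b) $[\bar p-\bar q]_\pm=\{[p_{i_1\dots i_n}-q_{i_1\dots i_n}]_\pm\}\in\widetilde{\mathfrak{P}}_0$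 for any $\bar q=\{q_{i_1\dots i_n}\}\in\mathfrak{P}_0$ with $\bar q\ne\bar p$, where $[x]_+=\max\{x,0\}$ and $[x]_-=\max\{-x,0\}$. Put $$D_f(\varepsilon)=(1+\varepsilon)(a_f+b_f)\!\left(\frac{\varepsilon}{1+\varepsilon}\right),$$ and let $\tilde a_f(\varepsilon)=a_f(\varepsilon)$ if $\varepsilon\in[0,\frac12]$ and $\tilde a_f(\varepsilon)=a_f(\frac12)$ if $\varepsilon\in(\frac12,1]$. A) If $f(\bar p)<+\infty$ then $$f(\bar q)\ge f(\bar p)-\tilde f(\bar p\wedge\varepsilon)-D_f(\varepsilon)-\tilde a_f(\varepsilon)$$ for any $\bar q\in\mathfrak{P}_0$ and $\varepsilon>0$ such that $\mathrm{TV}(\bar p,\bar q)\le\varepsilon\le1$. B) If either $f(\bar p)<+\infty$ or $\tilde f([\bar p-\varepsilon]_+)<+\infty$ for all $\varepsilon\in(0,1]$, then $$f(\bar q)\ge\tilde f([\bar p-\varepsilon]_+)-D_f(\varepsilon)-\tilde a_f(\varepsilon)-a_f(1-r_\varepsilon),\qquad r_\varepsilon=\sum_{i_1,\dots,i_n}[p_{i_1\dots i_n}-\varepsilon]_+,$$ for any $\bar q\in\mathfrak{P}_0$ and $\varepsilon>0$ such that $\mathrm{TV}(\bar p,\bar q)\le\varepsilon\le1$.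
   Context: $\mathbb{N}_0$ is the set of nonnegative integers. The total variation distance is $\mathrm{TV}(\bar p,\bar q)=\frac12\sum_{i_1,\dots,i_n}|p_{i_1\dots i_n}-q_{i_1\dots i_n}|$. $\bar p\wedge\varepsilon=\{\min\{p_{i_1\dots i_n},\varepsilon\}\}$ and $[\bar p-\varepsilon]_+=\{\max\{p_{i_1\dots i_n}-\varepsilon,0\}\}$ are $n$-variate arrays of nonnegative numbers. The cone $\widetilde{\mathfrak{P}}_0$ is the set of all arrays $\{cp_{i_1\dots i_n}\}$ with $\{p_{i_1\dots i_n}\}\in\mathfrak{P}_0$, $c\ge0$. The homogeneous extension is $\tilde f(\bar p)=\|\bar p\|_1f(\bar p/\|\bar p\|_1)$, $\|\bar p\|_1=\sum_{i_1,\dots,i_n}p_{i_1\dots i_n}$, for nonzero $\bar p\in\widetilde{\mathfrak{P}}_0$, and $\tilde f=0$ at the zero array. *)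

(* Defs.v *)
From mathcomp Require Import all_boot all_order all_algebra.
From mathcomp Require Import all_classical all_reals all_analysis.

Set Implicit Arguments.
Unset Strict Implicit.
Unset Printing Implicit Defensive.

Import Order.TTheory GRing.Theory Num.Theory.
Import numFieldNormedType.Exports.

Local Open Scope classical_set_scope.
Local Open Scope ring_scope.

(* The codomain is R^o so that arrays form an lmodType R (pointwise
   operations). *)
Notation array R n := (n.-tuple nat -> R^o).

Definition distributions (R : realType) (n : nat) : set (array R n) :=
  [set p | (forall i, 0 <= p i) /\
           (\esum_(i in [set: n.-tuple nat]) (p i)%:E = 1)%E].
Arguments distributions : clear implicits.

(* Meaningful for nonnegative arrays with finite sum: \esum is a supremum of
   finite partial sums, and fine sends +oo to 0. *)
Definition norm1 (R : realType) (n : nat) (p : array R n) : R :=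
  fine (\esum_(i in [set: n.-tuple nat]) (p i)%:E)%E.

Definition TV (R : realType) (n : nat) (p q : array R n) : \bar R :=
  ((2^-1)%:E * \esum_(i in [set: n.-tuple nat]) `|p i - q i|%:E)%E.

(* The set of all c *: p; this is the generated convex cone when P0 is
   convex. *)
Definition cone (R : realType) (n : nat) (P0 : set (array R n)) :
    set (array R n) :=
  [set x | exists c p, [/\ 0 <= c, P0 p & x = c *: p]].

Definition homext (R : realType) (n : nat) (f : array R n -> \bar R)
    (p : array R n) : \bar R :=
  if p == 0 then 0%E else ((norm1 p)%:E * f ((norm1 p)^-1 *: p)%R)%E.

Definition array_min (R : realType) (n : nat) (p : array R n) (e : R) :
    array R n :=
  fun i => Num.min (p i) e.

Definition array_excess (R : realType) (n : nat) (p : array R n) (e : R) :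
    array R n :=
  fun i => Num.max (p i - e) 0.

(* Concavity of a is convexity of its opposite. *)
Definition admissible_defect (R : realType) (a : R -> R) : Prop :=
  [/\ {within `[0, 1], continuous a},
      a 0 = 0,
      {in `[0, 1], forall l, a l = a (1 - l)},
      convex_function (`[0, 2^-1] : set R^o) (\- a) &
      {in `[0, 2^-1] &, {homo a : x y / x <= y}}].

Definition D_ (R : realType) (a b : R -> R) (e : R) : R :=
  (1 + e) * (a \+ b) (e / (1 + e)).

Definition flatten_half (R : realType) (a : R -> R) (e : R) : R :=
  if e <= 2^-1 then a e else a 2^-1.

(* Main.v *)
(* Write x = [p - q]_+ and z = [p - q]_-, two arrays of the cone of norm
   TV(p, q) with q + x = p + z.  The two hypotheses on f make its homogeneous
   extension f~ almost super- and subadditive, so exchanging the two sides of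
   q + x = p + z bounds f(p) by f(q) + f~(x) + D_f; since x <= min(p, eps),
   f~(x) is bounded by f~(min(p, eps)) up to the defect of a_f, provided that
   min(p, eps) - x is in the cone.  This membership is the delicate point.  If p
   takes two distinct positive values, restrictions of x to level sets of p, and
   their complements in functions of p, are obtained from arrays [p - q']_+
   where q' cancels p off the level set; if p has a single positive value its
   support is finite and one subtracts from x multiples of p one at a time.
   When f(p) is infinite, the exchange is applied to the restriction of p to
   {p > eta}, where the f~-values are finite, and then eta tends to 0. *)
Require Import Defs.
From mathcomp Require Import all_boot all_order all_algebra.
From mathcomp Require Import all_classical all_reals all_analysis.
From mathcomp Require Import finmap ring lra.

Set Implicit Arguments.
Unset Strict Implicit.
Unset Printing Implicit Defensive.

Import Order.TTheory GRing.Theory Num.Theory.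
Import numFieldNormedType.Exports.

Local Open Scope classical_set_scope.
Local Open Scope ring_scope.

(** * Summable nonnegative arrays and their norm *)

Section SummableArrays.
Context (R : realType) (n : nat).
Implicit Types (x y : array R n) (c : R).

Definition nonneg_summable x : Prop :=
  (forall i, 0 <= x i) /\
  (\esum_(i in [set: n.-tuple nat]) (x i)%:E < +oo)%E.

Lemma esum_array_ge0 x : (forall i, 0 <= x i) ->
  (0 <= \esum_(i in [set: n.-tuple nat]) (x i)%:E)%E.
Proof. by move=> x0; apply: esum_ge0 => i _; rewrite lee_fin. Qed.

Lemma norm1E x : nonneg_summable x ->
  (\esum_(i in [set: n.-tuple nat]) (x i)%:E)%E = (norm1 x)%:E.
Proof.
by move=> [x0 xoo]; rewrite /norm1 fineK// ge0_fin_numE// esum_array_ge0.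
Qed.

Lemma norm1_ge0 x : (forall i, 0 <= x i) -> 0 <= norm1 x.
Proof. by move=> x0; rewrite /norm1 fine_ge0// esum_array_ge0. Qed.

Lemma nonneg_summable_le x y : nonneg_summable y ->
  (forall i, 0 <= x i <= y i) -> nonneg_summable x.
Proof.
move=> [y0 yoo] xy; split=> [i|]; first by have /andP[] := xy i.
apply: le_lt_trans yoo; apply: le_esum => i _.
by rewrite lee_fin; have /andP[] := xy i.
Qed.

Lemma norm1_le x y : nonneg_summable y ->
  (forall i, 0 <= x i <= y i) -> norm1 x <= norm1 y.
Proof.
move=> sy xy; have sx := nonneg_summable_le sy xy.
rewrite -lee_fin -!norm1E//; apply: le_esum => i _.
by rewrite lee_fin; have /andP[] := xy i.
Qed.

Lemma norm1D_esum x y : nonneg_summable x -> nonneg_summable y ->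
  (\esum_(i in [set: n.-tuple nat]) ((x + y) i)%:E)%E
    = (norm1 x + norm1 y)%:E.
Proof.
move=> sx sy; rewrite EFinD -!norm1E// -esumD//.
- by move=> i _; rewrite lee_fin; case: sx.
- by move=> i _; rewrite lee_fin; case: sy.
Qed.

Lemma nonneg_summableD x y : nonneg_summable x -> nonneg_summable y ->
  nonneg_summable (x + y).
Proof.
move=> sx sy; split=> [i|]; last by rewrite norm1D_esum// ltry.
by rewrite addr_ge0//; [case: sx|case: sy].
Qed.

Lemma norm1D x y : nonneg_summable x -> nonneg_summable y ->
  norm1 (x + y) = norm1 x + norm1 y.
Proof. by move=> sx sy; rewrite {1}/norm1 norm1D_esum. Qed.

Lemma norm1_0 : norm1 (0 : array R n) = 0.
Proof. by rewrite /norm1 esum1. Qed.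

Lemma norm1Z_esum c x : 0 <= c -> nonneg_summable x ->
  (\esum_(i in [set: n.-tuple nat]) ((c *: x) i)%:E)%E = (c * norm1 x)%:E.
Proof.
move=> c0 sx; rewrite EFinM -norm1E// /esum.
rewrite -ereal_supZl//; last first.
  by apply/set0P; exists 0%E; exists set0; rewrite ?fsbig_set0//; split.
have cE A : (\sum_(i \in A) ((c *: x) i)%:E = c%:E * \sum_(i \in A) (x i)%:E)%E.
  by rewrite ge0_mule_fsumr// => i; rewrite lee_fin; case: sx.
congr ereal_sup; rewrite predeqE => r; split.
- by move=> [A fA] <-; exists (\sum_(i \in A) (x i)%:E)%E; [exists A|].
- by move=> [_ [A fA <-] <-]; exists A.
Qed.

Lemma nonneg_summableZ c x : 0 <= c -> nonneg_summable x ->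
  nonneg_summable (c *: x).
Proof.
move=> c0 sx; split=> [i|]; last by rewrite norm1Z_esum// ltry.
by rewrite mulr_ge0//; case: sx.
Qed.

Lemma norm1Z c x : 0 <= c -> nonneg_summable x ->
  norm1 (c *: x) = c * norm1 x.
Proof. by move=> c0 sx; rewrite {1}/norm1 norm1Z_esum. Qed.

Lemma sum_le_norm1 x (F : {fset n.-tuple nat}) : nonneg_summable x ->
  \sum_(i <- F) x i <= norm1 x.
Proof.
move=> sx; rewrite -lee_fin -norm1E//; apply: esum_ge.
exists [set` F]; first by split=> //; exact: finite_fset.
by rewrite fsbig_finite//= set_fsetK sumEFin.
Qed.

Lemma le_norm1 x i : nonneg_summable x -> x i <= norm1 x.
Proof.
by move=> /(sum_le_norm1 [fset i]%fset); rewrite big_seq_fset1.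
Qed.

Lemma norm1_eq0 x : nonneg_summable x -> norm1 x = 0 -> x = 0.
Proof.
move=> sx x0; apply/funext => i; apply/eqP; rewrite eq_le.
by rewrite -[X in _ <= X]x0 le_norm1//; case: sx => ->.
Qed.

Lemma norm1_gt0 x i : nonneg_summable x -> 0 < x i -> 0 < norm1 x.
Proof. by move=> sx /lt_le_trans; apply; apply: le_norm1. Qed.

(** A Markov count: an infinite level set would contain a finite set of more than [norm1 x / v]
    indices, and the entries of [x] on it would sum to more than [norm1 x]. *)
Lemma finite_level x v : nonneg_summable x -> 0 < v ->
  finite_set [set i | v <= x i].
Proof.
move=> sx v0; apply: contrapT => /infinite_set_fset.
move=> /(_ (Num.bound (norm1 x / v)))[F Fx cF].
have := sum_le_norm1 F sx; apply/negP; rewrite -ltNge.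
have : norm1 x / v < (Num.bound (norm1 x / v))%:R.
  by apply: archi_boundP; apply: divr_ge0 (ltW v0); apply: norm1_ge0; case: sx.
rewrite ltr_pdivrMr// => /lt_le_trans; apply.
apply: (@le_trans _ _ (\sum_(i <- F) v)); last first.
  by rewrite !big_seq; apply: ler_sum => i iF; apply: Fx.
rewrite big_const_seq count_predT iter_addr_0 -[leRHS]mulr_natl.
by rewrite ler_wpM2r ?(ltW v0)// ler_nat.
Qed.

End SummableArrays.

(** * The cone generated by a convex set of distributions *)

Section Cones.
Context (R : realType) (n : nat) (P0 : set (array R n)).
Hypothesis P0_sub : P0 `<=` distributions R n.
Implicit Types (x y : array R n) (c : R).

Lemma nonneg_summable_distribution x : P0 x -> nonneg_summable x.
Proof. by move=> /P0_sub[x0 x1]; split=> //; rewrite x1 ltry. Qed.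

Lemma norm1_distribution x : P0 x -> norm1 x = 1.
Proof. by move=> /P0_sub[x0 x1]; rewrite /norm1 x1. Qed.

Lemma nonneg_summable_cone x : cone P0 x -> nonneg_summable x.
Proof.
move=> [c [y [c0 Py ->]]].
exact: nonneg_summableZ c0 (nonneg_summable_distribution Py).
Qed.

Lemma cone_ge0 x i : cone P0 x -> 0 <= x i.
Proof. by move=> /nonneg_summable_cone[]. Qed.

Lemma norm1_cone_ge0 x : cone P0 x -> 0 <= norm1 x.
Proof. by move=> Kx; apply: norm1_ge0 => i; apply: cone_ge0. Qed.

Lemma cone_distribution x : P0 x -> cone P0 x.
Proof. by move=> Px; exists 1, x; split; rewrite ?scale1r. Qed.

Lemma coneZ c x : 0 <= c -> cone P0 x -> cone P0 (c *: x).
Proof.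
move=> c0 [d [y [d0 Py ->]]]; exists (c * d), y.
by split; rewrite ?mulr_ge0 ?scalerA.
Qed.

Lemma norm1_cone_eq0 x : cone P0 x -> (norm1 x == 0) = (x == 0).
Proof.
move=> /nonneg_summable_cone sx; apply/eqP/eqP => [|->]; last exact: norm1_0.
exact: norm1_eq0.
Qed.

Lemma norm1_cone_gt0 x : cone P0 x -> (0 < norm1 x) = (x != 0).
Proof.
move=> Kx; rewrite lt_def norm1_cone_eq0// norm1_ge0 ?andbT//.
by move=> i; apply: cone_ge0.
Qed.

(** The factor [c] of a representation [c *: y] is recovered as the norm, because the distribution
    [y] has norm 1. *)
Lemma distribution_normalized x : cone P0 x -> x != 0 ->
  P0 ((norm1 x)^-1 *: x).
Proof.
move=> [c [y [c0 Py xE]]] x0.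
have nE : norm1 x = c.
  rewrite xE norm1Z//; last exact: nonneg_summable_distribution.
  by rewrite norm1_distribution// mulr1.
have c1 : c != 0 by apply: contra_neq x0 => c1; rewrite xE c1 scale0r.
by rewrite nE xE scalerA mulVf// scale1r.
Qed.

Lemma distribution_cone x : cone P0 x -> norm1 x = 1 -> P0 x.
Proof.
move=> Kx x1; have x0 : x != 0 by rewrite -norm1_cone_gt0// x1.
by have := distribution_normalized Kx x0; rewrite x1 invr1 scale1r.
Qed.

Hypothesis P0_convex : convex_set P0.

Lemma distribution_conv x y l : P0 x -> P0 y -> 0 <= l <= 1 ->
  P0 (l *: x + (1 - l) *: y).
Proof.
move=> Px Py l01.
have /set_mem := P0_convex (Itv01 (andP l01).1 (andP l01).2)
  (mem_set Px) (mem_set Py).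
by [].
Qed.

(** Convexity of [P0] enters here: the sum is a multiple of the convex combination of the two
    normalized arrays, with weights proportional to their norms. *)
Lemma coneD x y : cone P0 x -> cone P0 y -> cone P0 (x + y).
Proof.
move=> Kx Ky.
have [->|x0] := eqVneq x 0; first by rewrite add0r.
have [->|y0] := eqVneq y 0; first by rewrite addr0.
have nx : 0 < norm1 x by rewrite norm1_cone_gt0.
have ny : 0 < norm1 y by rewrite norm1_cone_gt0.
have N0 : 0 < norm1 x + norm1 y by rewrite addr_gt0.
have l01 : 0 <= norm1 x / (norm1 x + norm1 y) <= 1.
  rewrite divr_ge0 ?(ltW nx) ?(ltW N0)//= ler_pdivrMr// mul1r lerDl.
  exact: ltW.
have := distribution_conv (distribution_normalized Kx x0)
  (distribution_normalized Ky y0) l01.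
set z := _ + _ => Pz; exists (norm1 x + norm1 y), z; split=> //.
  exact: ltW.
rewrite /z scalerDr !scalerA.
have -> : (norm1 x + norm1 y) * (norm1 x / (norm1 x + norm1 y)) / norm1 x = 1.
  by field; rewrite !lt0r_neq0.
have -> : (norm1 x + norm1 y) * (1 - norm1 x / (norm1 x + norm1 y)) / norm1 y
    = 1.
  by field; rewrite !lt0r_neq0.
by rewrite !scale1r.
Qed.

Lemma convex_combination_normalized x y : cone P0 x -> cone P0 y ->
  x != 0 -> y != 0 ->
  let l := norm1 x / norm1 (x + y) in
  [/\ 0 <= l <= 1, 1 - l = norm1 y / norm1 (x + y), 0 < norm1 (x + y) &
      (norm1 (x + y))^-1 *: (x + y) =
      l *: ((norm1 x)^-1 *: x) + (1 - l) *: ((norm1 y)^-1 *: y)].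
Proof.
move=> Kx Ky x0 y0 /=.
have nx : 0 < norm1 x by rewrite norm1_cone_gt0.
have ny : 0 < norm1 y by rewrite norm1_cone_gt0.
rewrite norm1D; [|exact: nonneg_summable_cone|exact: nonneg_summable_cone].
have N0 : 0 < norm1 x + norm1 y by rewrite addr_gt0.
have lE : 1 - norm1 x / (norm1 x + norm1 y) = norm1 y / (norm1 x + norm1 y).
  by field; rewrite !lt0r_neq0.
split=> //.
- rewrite divr_ge0 ?(ltW nx) ?(ltW N0)//= ler_pdivrMr// mul1r lerDl.
  exact: ltW.
- rewrite lE !scalerA scalerDr; congr (_ *: _ + _ *: _).
    by field; rewrite !lt0r_neq0.
  by field; rewrite !lt0r_neq0.
Qed.

End Cones.

(** * Almost super- and subadditivity of the homogeneous extension *)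

Lemma mule_weighted_sum (R : realType) (N c d : R) (u v : \bar R) :
  0 < N -> 0 <= c -> 0 <= d -> (0 <= u)%E -> (0 <= v)%E ->
  (N%:E * ((c / N)%:E * u + (d / N)%:E * v) = c%:E * u + d%:E * v)%E.
Proof.
move=> N0 c0 d0 u0 v0.
rewrite ge0_muleDr; last 2 first.
- by rewrite mule_ge0// lee_fin divr_ge0// ltW.
- by rewrite mule_ge0// lee_fin divr_ge0// ltW.
by rewrite !muleA -!EFinM !(mulrC N) !divfK ?lt0r_neq0.
Qed.

Section HomogeneousExtension.
Context (R : realType) (n : nat) (P0 : set (array R n)).
Hypothesis P0_sub : P0 `<=` distributions R n.
Context (f : array R n -> \bar R).
Hypothesis f_ge0 : forall x, P0 x -> (0 <= f x)%E.
Implicit Types (x y : array R n) (c : R).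

Lemma homext_distribution x : P0 x -> homext f x = f x.
Proof.
move=> Px; rewrite /homext ifF.
  by rewrite (norm1_distribution P0_sub Px) invr1 scale1r mul1e.
rewrite -(norm1_cone_eq0 P0_sub (cone_distribution Px)).
by rewrite (norm1_distribution P0_sub Px) oner_eq0.
Qed.

Lemma homext_ge0 x : cone P0 x -> (0 <= homext f x)%E.
Proof.
move=> Kx; rewrite /homext; case: eqVneq => // x0.
apply: mule_ge0; last by apply: f_ge0; apply: distribution_normalized.
by rewrite lee_fin ltW// (norm1_cone_gt0 P0_sub Kx).
Qed.

Lemma homextZ c x : 0 < c -> cone P0 x ->
  homext f (c *: x) = (c%:E * homext f x)%E.
Proof.
move=> c0 Kx; rewrite /homext scaler_eq0 gt_eqF//=.
case: eqVneq => [_|x0]; first by rewrite mule0.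
rewrite norm1Z ?(ltW c0)//; last exact: nonneg_summable_cone Kx.
have nx : 0 < norm1 x by rewrite (norm1_cone_gt0 P0_sub Kx).
rewrite EFinM muleA scalerA; congr (_ * f (_ *: _))%E.
by field; rewrite !lt0r_neq0.
Qed.

Hypothesis P0_convex : convex_set P0.

(** This is [f_lower] at the normalized arrays with weight [norm1 x / norm1 (x + y)], multiplied by
    [norm1 (x + y)]. The values of [a] at 0 and 1 settle the cases where a summand is the zero
    array. *)
Lemma homext_superadditive (a : R -> R) x y : a 0 = 0 -> a 1 = 0 ->
  (forall x y l, P0 x -> P0 y -> 0 <= l <= 1 ->
    (l%:E * f x + (1 - l)%:E * f y - (a l)%:E
       <= f (l *: x + (1 - l) *: y)%R)%E) ->
  cone P0 x -> cone P0 y ->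
  (homext f x + homext f y <=
   homext f (x + y)%R + (norm1 (x + y) * a (norm1 x / norm1 (x + y)))%:E)%E.
Proof.
move=> a0 a1 f_lower Kx Ky.
have [->|x0] := eqVneq x 0.
  rewrite norm1_0 mul0r a0 mulr0 adde0 add0r.
  by rewrite {1}/homext eqxx add0e.
have [->|y0] := eqVneq y 0.
  rewrite addr0 divff ?(norm1_cone_eq0 P0_sub Kx)// a1 mulr0 adde0.
  by rewrite {2}/homext eqxx adde0.
have [l01 lE N0 zE] := convex_combination_normalized P0_sub Kx Ky x0 y0.
have Px := distribution_normalized P0_sub Kx x0.
have Py := distribution_normalized P0_sub Ky y0.
have := f_lower _ _ _ Px Py l01.
have nx := norm1_cone_ge0 P0_sub Kx.
have ny := norm1_cone_ge0 P0_sub Ky.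
rewrite -zE lE /homext (negbTE x0) (negbTE y0).
rewrite -(norm1_cone_eq0 P0_sub (coneD P0_sub P0_convex Kx Ky)) gt_eqF//.
rewrite leeBlDr// => H.
rewrite -(mule_weighted_sum N0 nx ny (f_ge0 Px) (f_ge0 Py)).
rewrite (EFinM (norm1 (x + y))).
by rewrite -muleDr// ?fin_num_adde_defl// lee_wpmul2l// lee_fin ltW.
Qed.

Lemma homext_subadditive (b : R -> R) x y : b 0 = 0 -> b 1 = 0 ->
  (forall x y l, P0 x -> P0 y -> 0 <= l <= 1 ->
    (f (l *: x + (1 - l) *: y)%R
       <= l%:E * f x + (1 - l)%:E * f y + (b l)%:E)%E) ->
  cone P0 x -> cone P0 y ->
  (homext f (x + y)%R <=
   homext f x + homext f y +
     (norm1 (x + y) * b (norm1 x / norm1 (x + y)))%:E)%E.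
Proof.
move=> b0 b1 f_upper Kx Ky.
have [->|x0] := eqVneq x 0.
  rewrite norm1_0 mul0r b0 mulr0 adde0 add0r.
  by rewrite {2}/homext eqxx add0e.
have [->|y0] := eqVneq y 0.
  rewrite addr0 divff ?(norm1_cone_eq0 P0_sub Kx)// b1 mulr0 adde0.
  by rewrite {3}/homext eqxx adde0.
have [l01 lE N0 zE] := convex_combination_normalized P0_sub Kx Ky x0 y0.
have Px := distribution_normalized P0_sub Kx x0.
have Py := distribution_normalized P0_sub Ky y0.
have := f_upper _ _ _ Px Py l01.
have nx := norm1_cone_ge0 P0_sub Kx.
have ny := norm1_cone_ge0 P0_sub Ky.
rewrite -zE lE /homext (negbTE x0) (negbTE y0).
rewrite -(norm1_cone_eq0 P0_sub (coneD P0_sub P0_convex Kx Ky)) gt_eqF//.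
rewrite -(mule_weighted_sum N0 nx ny (f_ge0 Px) (f_ge0 Py)).
rewrite (EFinM (norm1 (x + y))).
rewrite -muleDr// ?fin_num_adde_defl// => H.
by rewrite lee_wpmul2l// lee_fin ltW.
Qed.

End HomogeneousExtension.

(** * Estimates for the defect functions *)

Section Defect.
Context (R : realType) (a : R -> R).
Hypothesis a_adm : admissible_defect a.

Lemma defect0 : a 0 = 0. Proof. by case: a_adm. Qed.

Lemma defect_sym l : 0 <= l <= 1 -> a l = a (1 - l).
Proof. by case: a_adm => _ _ + _ _ l01; apply; rewrite in_itv. Qed.

Lemma defect1 : a 1 = 0.
Proof. by rewrite defect_sym ?subrr ?defect0// ler01 lexx. Qed.

Lemma defect_le s t : 0 <= s -> s <= t -> t <= 2^-1 -> a s <= a t.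
Proof.
case: a_adm => _ _ _ _ H s0 st t2; apply: H => //.
  by rewrite in_itv/= s0 (le_trans st).
by rewrite in_itv/= (le_trans s0).
Qed.

Lemma defect_ge0 t : 0 <= t <= 2^-1 -> 0 <= a t.
Proof. by move=> /andP[t0 t2]; rewrite -[leLHS]defect0 defect_le. Qed.

(** Concavity between [t] and 0, where [a] vanishes. *)
Lemma defect_scale s t : 0 <= s <= 1 -> 0 <= t <= 2^-1 -> s * a t <= a (s * t).
Proof.
case: a_adm => _ _ _ H _ /andP[s0 s1] /andP[t0 t2].
have tI : (t : convex_lmodType R^o) \in (`[0, 2^-1]%classic : set R^o).
  by apply/mem_set; rewrite /= in_itv/= t0.
have zI : (0 : convex_lmodType R^o) \in (`[0, 2^-1]%classic : set R^o).
  by apply/mem_set; rewrite /= in_itv/= lexx/= invr_ge0.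
have := H (Itv01 s0 s1) _ _ tI zI.
rewrite /conv/= /conv/= /GRing.scale/= !mulr0 !addr0 defect0 oppr0 mulr0 addr0.
by rewrite mulrN lerN2.
Qed.

Lemma le_flatten_half t e : 0 <= t <= 2^-1 -> t <= e -> a t <= flatten_half a e.
Proof.
move=> /andP[t0 t2] te; rewrite /flatten_half; case: ifPn => [e2|_].
  exact: defect_le.
exact: defect_le.
Qed.

(** If [d / c] is at most one half, [defect_scale] moves the factor [c] inside and leaves [a d].
    Otherwise symmetry first replaces [d / c] by [1 - d / c], and the argument becomes [c - d],
    which is below both [d] and one half. *)
Lemma perspective_le_flatten_half c d e : 0 <= d -> d <= c -> c <= 1 ->
  d <= e -> c * a (d / c) <= flatten_half a e.
Proof.
move=> d0 dc c1 de.
have e0 : 0 <= e by apply: le_trans de.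
have [c0|c0] := eqVneq c 0.
  by rewrite c0 mul0r -[leLHS]defect0 le_flatten_half// lexx/= invr_ge0.
have {}c0 : 0 < c by rewrite lt_def c0 (le_trans d0).
have c01 : 0 <= c <= 1 by rewrite (ltW c0).
have dc0 : 0 <= d / c by rewrite divr_ge0// ltW.
have [dc2|dc2] := leP (d / c) 2^-1.
  have tI : 0 <= d / c <= 2^-1 by rewrite dc0.
  apply: le_trans (defect_scale c01 tI) _.
  rewrite mulrC divfK ?gt_eqF//; apply: le_flatten_half => //.
  rewrite d0/=; move: dc2; rewrite ler_pdivrMr// => /le_trans; apply.
  by rewrite ler_piMr// invr_ge0.
have dc1 : d / c <= 1 by rewrite ler_pdivrMr// mul1r.
have tI : 0 <= 1 - d / c <= 2^-1 by apply/andP; split; lra.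
rewrite defect_sym ?dc0// (le_trans (defect_scale c01 tI))//.
rewrite mulrBr mulr1 (mulrC c (d / c)) divfK ?gt_eqF//.
move: dc2; rewrite ltr_pdivlMr// => dc2.
by apply: le_flatten_half; [apply/andP; split|]; lra.
Qed.

(** By symmetry [1 / (1 + d)] may be replaced by [d / (1 + d)]; the map [t / (1 + t)] increases and
    stays at most one half for [t <= 1], where [a] is monotone. *)
Lemma defect_inv_le (d e : R) : 0 <= d -> d <= e -> e <= 1 ->
  (1 + d) * a (1 / (1 + d)) <= (1 + e) * a (e / (1 + e)).
Proof.
move=> d0 de e1.
have d1 : 0 < 1 + d by lra.
have e1' : 0 < 1 + e by lra.
have -> : a (1 / (1 + d)) = a (d / (1 + d)).
  rewrite defect_sym; first by congr a; field; rewrite gt_eqF.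
  by rewrite divr_ge0// ?(ltW d1)//= ler_pdivrMr//; lra.
have de2 : d / (1 + d) <= e / (1 + e).
  by rewrite ler_pdivrMr// mulrAC ler_pdivlMr//; nra.
have e2 : e / (1 + e) <= 2^-1 by rewrite ler_pdivrMr//; lra.
have dd : 0 <= d / (1 + d) by rewrite divr_ge0// ltW.
apply: ler_pM; [lra| |lra|exact: defect_le].
by rewrite defect_ge0// dd (le_trans de2).
Qed.

(** Continuity of [a] is given only within [0, 1]; the closed interval contains the sequence, hence
    also its limit. *)
Lemma defect_cvg (u : R^nat) l : (forall k, 0 <= u k <= 1) ->
  u @ \oo --> l -> (fun k => a (u k)) @ \oo --> a l.
Proof.
move=> u01 ul; have [ca _ _ _ _] := a_adm.
have l01 : `[0, 1]%classic l.
  rewrite /= in_itv/=; apply/andP; split.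
    by apply: (cvgr_to_ge ul); apply: nearW => k; have /andP[] := u01 k.
  by apply: (cvgr_to_le ul); apply: nearW => k; have /andP[] := u01 k.
move/subspace_continuousP : ca => /(_ l l01) ca.
apply: cvg_trans ca => P /ul H.
have {}H : \forall k \near \oo, `[0, 1]%classic (u k) -> P (a (u k)).
  exact: H.
rewrite /nbhs/=; near=> k; near: k.
apply: filterS H => k; apply; rewrite /= in_itv/=; exact: u01.
Unshelve. all: by end_near.
Qed.

End Defect.

(** The predicate tests the value [p i] instead of the index [i], so that restricting a function of
    [p] gives a function of [p] again. *)
Definition restrict_levels (R : realType) (n : nat) (p : array R n)
    (V : pred R) (x : array R n) : array R n :=
  fun i => if V (p i) then x i else 0.

(** * Membership in the cone of arrays built from [p] and [q] *)

Section SemicontinuityAtP.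
Context (R : realType) (n : nat) (P0 : set (array R n)).
Hypothesis P0_sub : P0 `<=` distributions R n.
Hypothesis P0_convex : convex_set P0.
Context (p : array R n).
Hypothesis P0p : P0 p.
Hypothesis p_fun : forall h : R -> R, (forall x, 0 <= x -> 0 <= h x <= x) ->
  cone P0 (h \o p).
Hypothesis p_diff : forall q, P0 q -> q <> p ->
  cone P0 ((p - q)^\+) /\ cone P0 ((p - q)^\-).
Implicit Types (x y : array R n) (V : pred R).

Local Notation K := (cone P0).
Local Notation "x |_ V" := (restrict_levels p V x) (at level 10).

Let p_ge0 i : 0 <= p i.
Proof. exact: (cone_ge0 P0_sub i (cone_distribution P0p)). Qed.

Let summable_p : nonneg_summable p.
Proof. exact: (nonneg_summable_distribution P0_sub P0p). Qed.

Let summable_cone x : K x -> nonneg_summable x.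
Proof. exact: nonneg_summable_cone. Qed.

(** For [q = p] both parts are the zero array, which lies in the cone. *)
Lemma cone_posneg q : P0 q -> K ((p - q)^\+) /\ K ((p - q)^\-).
Proof.
move=> Pq; have [->|/p_diff] := pselect (q = p); last exact.
have K0 : K 0 by exists 0, p; rewrite scale0r.
by split; rewrite [X in K X](_ : _ = 0)//; apply/funext => i;
  rewrite /funrpos /funrneg subrr/= ?oppr0 maxxx.
Qed.

Lemma cone_restrict_fun V (h : R -> R) :
  (forall t, 0 <= t -> 0 <= h t <= t) -> K ((h \o p) |_ V).
Proof.
move=> hP; rewrite [X in K X](_ : _ = (fun t => if V t then h t else 0) \o p)//.
by apply: p_fun => t t0; case: ifP => _; rewrite ?hP ?lexx.
Qed.

(* The complement is a multiple of [p - q]_+ for a distribution q equal to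
   x + p - u(p) on V and dominating p off V; the mass that q must lose on V is
   at least the mass of x, and the excess is spread off V. *)
Lemma cone_restrict_sub_small V (u : R -> R) x :
  (forall t, 0 <= t -> 0 <= u t <= t) -> 0 < norm1 (p |_ (predC V)) ->
  K x -> (forall i, V (p i) -> x i <= u (p i)) ->
  norm1 x <= norm1 ((u \o p) |_ V) ->
  K ((fun i => u (p i) - x i) |_ V).
Proof.
move=> uP m0 Kx xu xU.
set m := norm1 (p |_ (predC V)) in m0 *.
set U := norm1 ((u \o p) |_ V) in xU *.
(* The function [h] must stay below the identity, whereas [q] is to exceed [p] off [V]. Hence the
   common factor [k] in front, divided away on [V]; its value gives [q] total mass one. *)
pose k := 1 + (U - norm1 x) / m.
have k1 : 1 <= k by rewrite lerDl divr_ge0 ?subr_ge0// ltW.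
have k0 : 0 < k by apply: lt_le_trans k1.
pose h t := if V t then (t - u t) / k else t.
have hP t : 0 <= t -> 0 <= h t <= t.
  move=> t0; have /andP[u0 ut] := uP _ t0.
  rewrite /h; case: ifP => _; last by rewrite t0 lexx.
  rewrite divr_ge0 ?subr_ge0 ?(ltW k0)//= ler_pdivrMr//.
  by apply: (@le_trans _ _ t); [lra|rewrite ler_peMr].
have Kg : K (k *: (h \o p)) by apply: coneZ; [exact: ltW|exact: p_fun].
have Ku : K ((u \o p) |_ V) by apply: cone_restrict_fun.
have Km : K (p |_ (predC V)).
  by apply: (@cone_restrict_fun _ id) => t ->; rewrite lexx.
have gE : k *: (h \o p) + (u \o p) |_ V =
    p + ((U - norm1 x) / m) *: (p |_ (predC V)).
  apply/funext => i; rewrite !fctE /h /restrict_levels /=.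
  rewrite /GRing.scale/=; case: ifP => _ /=.
    by rewrite mulrC divfK ?lt0r_neq0// mulr0 addr0 subrK.
  by rewrite /k addr0 mulrDl mul1r.
have gn : norm1 (k *: (h \o p)) + norm1 x = 1.
  have := congr1 (@norm1 R n) gE.
  have d0 : 0 <= (U - norm1 x) / m by rewrite divr_ge0 ?subr_ge0// ltW.
  have sm := summable_cone Km.
  rewrite (norm1D (summable_cone Kg) (summable_cone Ku)).
  rewrite (norm1D summable_p (nonneg_summableZ d0 sm)) norm1Z//.
  by rewrite -/U -/m divfK ?lt0r_neq0// (norm1_distribution P0_sub P0p); lra.
have Kq : K (x + k *: (h \o p)) by apply: coneD.
have Pq : P0 (x + k *: (h \o p)).
  apply: (distribution_cone P0_sub Kq).
  by rewrite norm1D 1?addrC//; apply: summable_cone.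
have [+ _] := cone_posneg Pq.
rewrite [X in K X -> _](_ : _ = (fun i => u (p i) - x i) |_ V)//.
apply/funext => i; rewrite /funrpos /restrict_levels !fctE /h /=.
rewrite /GRing.scale/=; case: ifPn => Vi.
  rewrite mulrCA divff ?lt0r_neq0// mulr1.
  have -> : p i - (x i + (p i - u (p i))) = u (p i) - x i by lra.
  by apply/max_idPl; rewrite subr_ge0 xu.
apply/max_idPr; have := cone_ge0 P0_sub i Kx; have := p_ge0 i.
by move=> p0 x0; have : p i <= k * p i by [rewrite ler_peMl|]; lra.
Qed.

(** Complementing twice: with [x] scaled down by [C], first [p - x / C] on [V] and then its own
    complement [x / C] on [V] are obtained from [cone_restrict_sub_small], and multiplication by [C]
    restores [x]. *)
Lemma cone_restrict V x :
  0 < norm1 (p |_ V) -> 0 < norm1 (p |_ (predC V)) ->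
  K x -> (forall i, V (p i) -> x i <= p i) -> K (x |_ V).
Proof.
move=> pV0 pVC0 Kx xp.
have nx : 0 <= norm1 x by apply: norm1_ge0; case: (summable_cone Kx).
(* Chosen so that [norm1 x / C] is at most the mass of [p] on [V], while [C >= 1] keeps [x / C]
   below [p] there. *)
pose C := 1 + norm1 x / norm1 (p |_ V).
have C1 : 1 <= C by rewrite lerDl divr_ge0// ltW.
have C0 : 0 < C by apply: lt_le_trans C1.
have idP (t : R) : 0 <= t -> 0 <= idfun t <= t by move=> ->; rewrite /= lexx.
have KpV : K (p |_ V) by apply: (@cone_restrict_fun _ idfun).
have Kx1 : K (C^-1 *: x) by apply: coneZ => //; rewrite invr_ge0 ltW.
have x10 i : 0 <= C^-1 * x i by exact: (cone_ge0 P0_sub i Kx1).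
have Ky : K ((fun i => p i - C^-1 * x i) |_ V).
  apply: (@cone_restrict_sub_small _ idfun) => //.
  - move=> i Vi /=; rewrite /GRing.scale/= ler_pdivrMl//.
    by apply: (le_trans (xp _ Vi)); rewrite ler_peMl.
  - rewrite norm1Z ?invr_ge0 ?(ltW C0)//; last exact: summable_cone.
    rewrite ler_pdivrMl// /C mulrDl mul1r divfK ?lt0r_neq0//.
    by rewrite lerDr ltW.
have : K ((fun i => p i - ((fun i => p i - C^-1 * x i) |_ V) i) |_ V).
  apply: (@cone_restrict_sub_small _ idfun) => //.
  - by move=> i Vi; rewrite /restrict_levels Vi/= gerBl.
  - apply: norm1_le (summable_cone KpV) _ => i; rewrite /restrict_levels.
    case: ifP => Vi; rewrite ?lexx// gerBl x10 andbT subr_ge0.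
    rewrite ler_pdivrMl//.
    by apply: (le_trans (xp _ Vi)); rewrite ler_peMl.
move=> /(coneZ (ltW C0)); congr K; apply/funext => i.
rewrite fctE /restrict_levels /GRing.scale/=.
case: ifP => Vi; last by rewrite mulr0.
by rewrite Vi subKr mulVKf// lt0r_neq0.
Qed.

(** Replacing [x] by its restriction to [V] supplies the mass condition of
    [cone_restrict_sub_small], since on [V] it lies below [u(p)] entry by entry. *)
Lemma cone_restrict_sub V (u : R -> R) x :
  0 < norm1 (p |_ V) -> 0 < norm1 (p |_ (predC V)) ->
  (forall t, 0 <= t -> 0 <= u t <= t) -> K x ->
  (forall i, V (p i) -> x i <= u (p i)) ->
  K ((fun i => u (p i) - x i) |_ V).
Proof.
move=> pV0 pVC0 uP Kx xu.
have KxV : K (x |_ V).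
  apply: cone_restrict => // i Vi; apply: le_trans (xu _ Vi) _.
  by have /andP[] := uP _ (p_ge0 i).
have := cone_restrict_sub_small uP pVC0 KxV.
rewrite [X in _ -> _ -> K X](_ : _ = (fun i => u (p i) - x i) |_ V).
  apply.
  - by move=> i Vi; rewrite /restrict_levels Vi xu.
  - apply: norm1_le (summable_cone (cone_restrict_fun V uP)) _ => i.
    rewrite /restrict_levels; case: ifP => [Vi| _]; rewrite ?lexx//=.
    by rewrite xu// (cone_ge0 P0_sub i Kx).
by apply/funext => i; rewrite /restrict_levels; case: ifP => // Vi; rewrite Vi.
Qed.

Lemma exists_p_gt0 : exists i, 0 < p i.
Proof.
apply: contrapT => /forallNP p0.
have : p != 0.
  by rewrite -(norm1_cone_gt0 P0_sub (cone_distribution P0p))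
    (norm1_distribution P0_sub P0p).
apply/negP; rewrite negbK; apply/eqP/funext => i; apply/eqP.
by rewrite eq_le p_ge0 leNgt andbT; apply/negP.
Qed.

Lemma seq_argmin (I : eqType) (r : I -> R) (s : seq I) : s != [::] ->
  exists2 i, i \in s & forall j, j \in s -> r i <= r j.
Proof.
elim: s => // j s IH _; have [->|/IH[i si ri]] := eqVneq s [::].
  by exists j => [|k]; rewrite !inE// => /eqP ->.
have [ij|ji] := leP (r i) (r j).
  by exists i => [|k]; rewrite inE ?si ?orbT// => /predU1P[->|/ri].
exists j => [|k]; rewrite inE ?eqxx// => /predU1P[->//|/ri].
exact/le_trans/ltW.
Qed.

(** These are the two parts of [p - q] for the distribution [q = x / norm1 x], multiplied back by
    [norm1 x]. *)
Lemma cone_centered x : K x -> x != 0 ->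
  K (fun i => Num.max (x i - norm1 x * p i) 0) /\
  K (fun i => Num.max (norm1 x * p i - x i) 0).
Proof.
move=> Kx x0; have t0 : 0 < norm1 x by rewrite (norm1_cone_gt0 P0_sub Kx).
have [] := cone_posneg (distribution_normalized P0_sub Kx x0).
move=> /(coneZ (ltW t0)) Kp /(coneZ (ltW t0)) Kn; split.
  rewrite [X in K X](_ : _ = norm1 x *: (p - (norm1 x)^-1 *: x)^\-)//.
  apply/funext => i; rewrite /funrneg !fctE/= /GRing.scale/=.
  by rewrite maxr_pMr ?(ltW t0)// mulr0 mulrN mulrBr mulVKf ?lt0r_neq0// opprB.
rewrite [X in K X](_ : _ = norm1 x *: (p - (norm1 x)^-1 *: x)^\+)//.
apply/funext => i; rewrite /funrpos !fctE/= /GRing.scale/=.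
by rewrite maxr_pMr ?(ltW t0)// mulr0 mulrBr mulVKf ?lt0r_neq0.
Qed.

(* Induction on the support of x: subtracting from x the multiple t p with
   t = norm1 x, or, when t p < x on the whole support, the multiple of p that
   vanishes off the support and is tight at a point i0 minimizing x / p. *)
Lemma cone_scale_sub_finite (s : seq (n.-tuple nat)) (k : R) x : K x ->
  (forall i, x i != 0 -> i \in s) -> (forall i, x i <= k * p i) ->
  K (k *: p - x).
Proof.
have [N] := ubnP (size s); elim: N => // N IH in s k x *.
rewrite ltnS => sN Kx xs xk.
have k0 : 0 <= k.
  have [i pi0] := exists_p_gt0.
  rewrite -(pmulr_lge0 _ pi0); apply: le_trans (xk i).
  exact: (cone_ge0 P0_sub i Kx).
have [->|x0] := eqVneq x 0.
  by rewrite subr0; apply: coneZ k0 (cone_distribution P0p).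
have t0 : 0 < norm1 x by rewrite (norm1_cone_gt0 P0_sub Kx).
set t := norm1 x in t0 *.
have tk : t <= k.
  rewrite -[k]mulr1 -(norm1_distribution P0_sub P0p) -norm1Z//.
  apply: norm1_le; first exact: nonneg_summableZ.
  by move=> i; rewrite xk (cone_ge0 P0_sub i Kx).
have [KA KB] := cone_centered Kx x0; rewrite -/t in KA KB.
pose S := [seq i <- s | x i != 0].
have Sx i : (i \in S) = (x i != 0).
  by rewrite mem_filter andb_idr//; apply: xs.
have S0 : S != [::].
  apply: contra_neq x0 => S0; apply/funext => i; apply/eqP.
  by rewrite -[_ == _]negbK -Sx S0.
have xgt0 i : x i != 0 -> 0 < x i.
  by move=> xi0; rewrite lt_def xi0 (cone_ge0 P0_sub i Kx).
have [i0 Si0 min0] := seq_argmin (fun i => x i / p i) S0.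
have si0 : i0 \in s by apply: xs; rewrite -Sx.
have filterN : (size [seq i <- s | predC1 i0 i] < N)%N.
  apply: leq_trans sN; rewrite size_filter -(count_predC (pred1 i0) s).
  by rewrite -[X in (X < _)%N]add0n ltn_add2r -has_count has_pred1.
(* The support of [A] has lost the index [i0], so the induction hypothesis puts [(k - l) *: p - A]
   in the cone; adding [B] yields [k *: p - x]. *)
have step l A B : 0 <= k - l -> K A -> K B -> A i0 = 0 ->
    (forall i, x i = 0 -> A i = 0) ->
    (forall i, A i <= (k - l) * p i) ->
    (forall i, x i = l * p i + A i - B i) -> K (k *: p - x).
  move=> kl0 KA' KB' A0 Ax Ak xE.
  have : K ((k - l) *: p - A).
    apply: (IH [seq i <- s | predC1 i0 i]) => //.
    - move=> i Ai0; rewrite mem_filter /=; apply/andP; split.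
        by apply: contra_neq Ai0 => ->.
      by apply: xs; apply: contra_neq Ai0 => /Ax.
  move=> /(coneD P0_sub P0_convex KB'); congr K; apply/funext => i.
  by rewrite !fctE/= /GRing.scale/= xE; ring.
(* In the first case centering at [t] already makes [A] vanish at [i0]. *)
have [xt|xt] := leP (x i0) (t * p i0).
  apply: (step t _ _ _ KA KB) => //.
  - by rewrite subr_ge0.
  - by apply/max_idPr; rewrite subr_le0.
  - move=> i ->; apply/max_idPr; rewrite sub0r oppr_le0 mulr_ge0//.
    exact: ltW.
  - move=> i; rewrite ge_max mulrBl lerD2r xk/= -mulrBl mulr_ge0//.
    by rewrite subr_ge0.
  - move=> i; rewrite /Num.max; case: ltP => ?; case: ltP => ?; lra.
have p_gt0 i : x i != 0 -> 0 < p i.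
  move=> xi0; rewrite lt_def p_ge0 andbT; apply: contraTneq (xgt0 _ xi0) => pi.
  by rewrite -leNgt; have := xk i; rewrite pi mulr0.
have xi0 : x i0 != 0 by rewrite -Sx.
(* Every ratio [x i / p i] on the support of [x] now exceeds [t], so the centering has to be raised
   from [t] to the least ratio [l]. *)
pose l := x i0 / p i0.
have tl : t < l by rewrite ltr_pdivlMr// p_gt0.
have l0 : 0 < l by apply: lt_trans tl.
have lx i : x i != 0 -> l * p i <= x i.
  by move=> xi; rewrite -ler_pdivlMr ?p_gt0// min0// Sx.
have lk : l <= k by rewrite ler_pdivrMr ?p_gt0.
set A := (fun i => Num.max (x i - t * p i) 0) in KA.
set B := (fun i => Num.max (t * p i - x i) 0) in KB.
have BE i : B i = if x i == 0 then t * p i else 0.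
  rewrite /B; case: eqVneq => [->|xi].
    by rewrite subr0 max_l// mulr_ge0// ltW.
  apply/max_idPr; rewrite subr_le0 (le_trans _ (lx _ xi))//.
  by rewrite ler_wpM2r// ltW.
(* From [x + B = t *: p + A], where [x] and [t *: p] have the same norm, [A] and [B] have the same
   norm; and [A] is positive at [i0]. *)
have B0 : 0 < norm1 B.
  rewrite (norm1_cone_gt0 P0_sub KB) -(norm1_cone_eq0 P0_sub KB).
  suff -> : norm1 B = norm1 A.
    rewrite gt_eqF//; apply: (@norm1_gt0 _ _ _ i0); first exact: summable_cone.
    by rewrite /A lt_max subr_gt0 xt.
  apply: (@addrI _ t); rewrite {1}/t -norm1D; [|exact: summable_cone..].
  have -> : x + B = t *: p + A.
    apply/funext => i; rewrite !fctE/= /A /B /GRing.scale/=.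
    by rewrite /Num.max; case: ltP => ?; case: ltP => ?; lra.
  rewrite norm1D; [|exact: nonneg_summableZ (ltW t0) _|exact: summable_cone].
  by rewrite (norm1Z (ltW t0))// (norm1_distribution P0_sub P0p) mulr1.
(* Compare norms in [l *: p <= x + (l / t) *: B]: on the support of [x] this is the minimality of
   [l], and off it [B] equals [t *: p]. *)
have lB : l <= t + l / t * norm1 B.
  have lt0 : 0 <= l / t by rewrite divr_ge0 ?ltW.
  have sB := nonneg_summableZ lt0 (summable_cone KB).
  rewrite -[leLHS]mulr1 -(norm1_distribution P0_sub P0p) -(norm1Z (ltW l0))//.
  rewrite -(norm1Z lt0) -?norm1D//; try exact: summable_cone.
  apply: norm1_le; first exact: nonneg_summableD (summable_cone Kx) sB.
  move=> i; rewrite !fctE/= /GRing.scale/= mulr_ge0 ?(ltW l0)//= BE.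
  case: eqVneq => [->|/lx]; last by rewrite mulr0 addr0.
  by rewrite add0r mulrA divfK// gt_eqF.
(* Adding [c *: B], which vanishes on the support of [x], raises the norm from [t] to [l], so that
   [cone_centered] centers at [l *: p]. *)
pose c := (l - t) / norm1 B.
have c0 : 0 <= c by rewrite divr_ge0 ?subr_ge0 ?ltW.
have Kz : K (x + c *: B) by apply: (coneD P0_sub) => //; apply: coneZ.
have nz : norm1 (x + c *: B) = l.
  rewrite norm1D ?norm1Z//; try exact: summable_cone.
    by rewrite divfK ?gt_eqF// subrKC.
  exact: nonneg_summableZ (summable_cone KB).
(* A rearrangement of [lB]. It keeps [x + c *: B] below [l *: p] off the support of [x], so the
   positive part there is zero. *)
have ctl : c * t <= l.
  rewrite /c mulrAC ler_pdivrMr// -ler_pdivlMr//.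
  rewrite mulrAC; lra.
have z0 : x + c *: B != 0 by rewrite -(norm1_cone_gt0 P0_sub Kz) nz.
have [KA' _] := cone_centered Kz z0; rewrite nz in KA'.
have lt0 : 0 <= l / t by rewrite divr_ge0 ?ltW.
have A'E i : Num.max ((x + c *: B) i - l * p i) 0 =
    if x i == 0 then 0 else x i - l * p i.
  rewrite !fctE/= /GRing.scale/= BE; case: eqVneq => [->|xi].
    by apply/max_idPr; rewrite add0r mulrA -mulrBl mulr_le0_ge0// subr_le0.
  by rewrite mulr0 addr0; apply/max_idPl; rewrite subr_ge0 lx.
apply: (step l _ ((l / t) *: B) _ KA' (coneZ lt0 KB)).
- by rewrite subr_ge0.
- by rewrite A'E (negbTE xi0) divfK ?subrr// gt_eqF// p_gt0.
- by move=> i xi; rewrite A'E xi eqxx.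
- move=> i; rewrite A'E; case: eqVneq => _.
    by rewrite mulr_ge0// subr_ge0.
  by rewrite mulrBl lerB.
- move=> i; rewrite A'E fctE BE; case: eqVneq => [->| _]; last by ring.
  by rewrite /GRing.scale/= addr0 mulrA divfK ?subrr// gt_eqF.
Qed.

Lemma restrict_norm1_gt0 V i : V (p i) -> 0 < p i -> 0 < norm1 (p |_ V).
Proof.
move=> Vi pi0; apply: (@norm1_gt0 _ _ _ i); last by rewrite /restrict_levels Vi.
apply: nonneg_summable_le summable_p _ => j; rewrite /restrict_levels.
by case: ifP; rewrite p_ge0 lexx.
Qed.

Lemma min_between (e : R) : 0 <= e ->
  forall t, 0 <= t -> 0 <= Num.min t e <= t.
Proof. by move=> e0 t t0; rewrite le_min t0 e0 ge_min lexx. Qed.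

Lemma funrpos_sub_le q i : P0 q -> (p - q)^\+ i <= p i.
Proof.
move=> Pq; rewrite /funrpos ge_max !fctE p_ge0 andbT gerBl.
exact: (cone_ge0 P0_sub i (cone_distribution Pq)).
Qed.

Lemma cone_min_sub q (e : R) : P0 q -> 0 <= e -> norm1 ((p - q)^\+) <= e ->
  K (array_min p e - (p - q)^\+).
Proof.
move=> Pq e0; have [Kx _] := cone_posneg Pq.
have xp i := funrpos_sub_le i Pq; move: Kx xp.
set x := (p - q)^\+ => Kx xp xe.
(* An entry is at most the norm, which is at most [e]. *)
have xu i : x i <= Num.min (p i) e.
  by rewrite le_min xp (le_trans _ xe)//; apply: le_norm1; exact: summable_cone.
have uP := min_between e0.
have [i1 pi1] := exists_p_gt0.
(* With a second positive value, the level of [p i1] and its complement both carry mass, and the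
   differences restricted to each of them add up to the whole. *)
have [[j [pj0 pj]]|/forallNP puni] :=
  pselect (exists j, 0 < p j /\ p j != p i1).
  have V0 : 0 < norm1 (p |_ (pred1 (p i1))).
    by apply: (@restrict_norm1_gt0 _ i1) => //=.
  have VC0 : 0 < norm1 (p |_ (predC (pred1 (p i1)))).
    by apply: (@restrict_norm1_gt0 _ j).
  have VCC : 0 < norm1 (p |_ (predC (predC (pred1 (p i1))))).
    by apply: (@restrict_norm1_gt0 _ i1) => //=; rewrite negbK.
  have restrict V := @cone_restrict_sub V (fun t => Num.min t e) x.
  have K1 := restrict _ V0 VC0 uP Kx (fun i _ => xu i).
  have K2 := restrict _ VC0 VCC uP Kx (fun i _ => xu i).
  have := coneD P0_sub P0_convex K1 K2; congr K; apply/funext => i.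
  rewrite !fctE /restrict_levels/=.
  by case: ifP => _; rewrite ?addr0 ?add0r.
have pE i : p i != 0 -> p i = p i1.
  move=> pi0; apply/eqP/negPn/negP => pi; apply: (puni i); split=> //.
  by rewrite lt_def pi0 p_ge0.
(* When [p i1] is the only positive value, [array_min p e] is [k] times [p]. *)
pose k := Num.min (p i1) e / p i1.
have kE i : k * p i = Num.min (p i) e.
  have [->|pi0] := eqVneq (p i) 0; first by rewrite mulr0 min_l.
  by rewrite (pE i)// /k divfK ?gt_eqF.
have /finite_seqP[s sE] := finite_level summable_p pi1.
have := @cone_scale_sub_finite s k x Kx.
rewrite [X in _ -> _ -> K X](_ : _ = array_min p e - x).
  apply.
  - move=> i xi0; have : [set i | p i1 <= p i] i.
      rewrite /= -(pE i)//; apply: contra_neq xi0 => pi0.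
      apply/eqP; rewrite eq_le (cone_ge0 P0_sub i Kx) andbT.
      by rewrite -pi0 xp.
    by rewrite sE.
  - by move=> i; rewrite kE.
by apply/funext => i; rewrite !fctE/= /GRing.scale/= kE.
Qed.

(** Since [p] and [q] have equal mass, so do the two parts of [p - q]; the total variation distance,
    half the sum of their norms, is this common norm. *)
Lemma TV_norm1_le q (e : R) : P0 q -> (TV p q <= e%:E)%E ->
  norm1 ((p - q)^\+) = norm1 ((p - q)^\-) /\ norm1 ((p - q)^\+) <= e.
Proof.
move=> Pq pqe; have [Kx Kz] := cone_posneg Pq.
have xz : norm1 ((p - q)^\+) = norm1 ((p - q)^\-).
  have : q + (p - q)^\+ = p + (p - q)^\-.
    apply/funext => i; rewrite !fctE /funrpos /funrneg.
    by rewrite /Num.max; case: ltP => ?; case: ltP => ?; lra.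
  move=> /(congr1 (@norm1 R n)).
  rewrite (norm1D (summable_cone (cone_distribution Pq)) (summable_cone Kx)).
  rewrite (norm1D summable_p (summable_cone Kz)).
  rewrite (norm1_distribution P0_sub Pq) (norm1_distribution P0_sub P0p).
  exact: addrI.
split=> //; move: pqe; rewrite /TV.
have -> : (\esum_(i in [set: n.-tuple nat]) `|p i - q i|%:E =
    (norm1 ((p - q)^\+) + norm1 ((p - q)^\-))%:E)%E.
  rewrite -norm1D_esum; [|exact: summable_cone..].
  by apply: eq_esum => i _; rewrite funrposDneg.
by rewrite -EFinM lee_fin -xz; lra.
Qed.

Lemma exists_level_cutoff (s : seq (n.-tuple nat)) (e : R) : 0 < e ->
  exists eta, [/\ 0 < eta, eta < e & forall i, i \in s -> 0 < p i -> eta < p i].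
Proof.
move=> e0; elim: s => [|i s [eta [eta0 etae H]]].
  by exists (e / 2); split=> //; [rewrite divr_gt0|lra].
have [pi0|pi0] := ltP 0 (p i).
  exists (Num.min eta (p i / 2)); split=> [||j].
  - by rewrite lt_min eta0 divr_gt0.
  - by rewrite gt_min etae.
  - rewrite inE gt_min => /predU1P[-> _|/H H' /H' ->//].
    by apply/orP; right; lra.
exists eta; split=> // j; rewrite inE => /predU1P[->|]; last exact: H.
by rewrite ltNge pi0.
Qed.

(** Some finite partial sum of [p] exceeds [1 - k]; [eta] is taken below all positive entries in
    it. *)
Lemma exists_level_mass (e k : R) : 0 < e -> 0 < k ->
  exists eta, [/\ 0 < eta, eta < e & 1 - k < norm1 (p |_ (> eta))].
Proof.
move=> e0 k0.
have : (((1 - k)%:E < \esum_(i in [set: n.-tuple nat]) (p i)%:E)%E).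
  by rewrite norm1E// (norm1_distribution P0_sub P0p) lte_fin; lra.
move=> /ereal_sup_gt[_ [A [fA _] <-]].
have /finite_fsetP[F AF] := fA; subst A.
rewrite fsbig_finite//= set_fsetK sumEFin lte_fin => kF.
have [eta [eta0 etae H]] := exists_level_cutoff F e0.
exists eta; split=> //; apply: lt_le_trans kF _.
have KV : K (p |_ (> eta)).
  by apply: (@cone_restrict_fun _ idfun) => t t0; rewrite t0 lexx.
apply: le_trans (sum_le_norm1 F (summable_cone KV)).
rewrite !big_seq; apply: ler_sum => i iF; rewrite /restrict_levels.
case: ifPn => // /=; have [/(H _ iF) ->//|] := ltP 0 (p i).
by [].
Qed.

(** * Exchange and cancellation inequalities for the homogeneous extension *)

Context (a b : R -> R) (f : array R n -> \bar R).
Hypotheses (a_adm : admissible_defect a) (b_adm : admissible_defect b).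
Hypothesis f_ge0 : forall x, P0 x -> (0 <= f x)%E.
Hypothesis f_lower : forall x y l, P0 x -> P0 y -> 0 <= l <= 1 ->
  (l%:E * f x + (1 - l)%:E * f y - (a l)%:E <= f (l *: x + (1 - l) *: y)%R)%E.
Hypothesis f_upper : forall x y l, P0 x -> P0 y -> 0 <= l <= 1 ->
  (f (l *: x + (1 - l) *: y)%R <= l%:E * f x + (1 - l)%:E * f y + (b l)%:E)%E.

Local Notation h := (homext f).

Let h_super x y (Kx : K x) (Ky : K y) :=
  homext_superadditive P0_sub f_ge0 P0_convex (defect0 a_adm) (defect1 a_adm)
    f_lower Kx Ky.

Let h_sub x y (Kx : K x) (Ky : K y) :=
  homext_subadditive P0_sub f_ge0 P0_convex (defect0 b_adm) (defect1 b_adm)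
    f_upper Kx Ky.

(** Almost monotonicity: superadditivity with the nonnegative term [h y] dropped. *)
Lemma homext_le_add x y : K x -> K y ->
  (h x <= h (x + y)%R + (norm1 (x + y) * a (norm1 x / norm1 (x + y)))%:E)%E.
Proof.
move=> Kx Ky; apply: le_trans (h_super Kx Ky).
by rewrite leeDl// (homext_ge0 P0_sub f_ge0 Ky).
Qed.

(* The Alicki-Fannes-Winter exchange. *)
Lemma homext_exchange q x y w z e : P0 q -> K x -> K y -> K w -> K z ->
  w + z = q + x -> norm1 x <= e -> norm1 (x + y) <= 1 ->
  (h w <= f q + h (x + y)%R +
    ((1 + norm1 x) * (a (norm1 w / (1 + norm1 x)) + b (1 / (1 + norm1 x)))
      + flatten_half a e)%:E)%E.
Proof.
move=> Pq Kx Ky Kw Kz wz xe xy1.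
have Kq := cone_distribution Pq.
have nq := norm1_distribution P0_sub Pq.
have nN : norm1 (q + x) = 1 + norm1 x.
  by rewrite (norm1D (summable_cone Kq) (summable_cone Kx)) nq.
have nxy : norm1 x <= norm1 (x + y).
  rewrite norm1D; [|exact: summable_cone..].
  by rewrite lerDl; apply: norm1_ge0; case: (summable_cone Ky).
have nx0 : 0 <= norm1 x by apply: norm1_ge0; case: (summable_cone Kx).
(* The chain runs from [w] up to [w + z = q + x], splits off [q] by subadditivity, and then enlarges
   [x] to [x + y]; the defect of the last step is absorbed in [flatten_half a e]. *)
have := homext_le_add Kw Kz; rewrite wz nN => H1.
have := h_sub Kq Kx; rewrite nN nq (homext_distribution P0_sub f Pq) => H2.
have H3 := homext_le_add Kx Ky.
have H4 := perspective_le_flatten_half a_adm nx0 nxy xy1 xe.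
apply: (le_trans H1); rewrite mulrDr !EFinD.
apply: (le_trans (leeD2r _ H2)).
rewrite -!addeA leeD2l//.
apply: (le_trans (leeD2r _ H3)).
rewrite -!addeA leeD2l// -!EFinD lee_fin; lra.
Qed.

(** Superadditivity bounds [h m + h w], and the finite term [h m] cancels. *)
Lemma homext_cancel m w F T : K m -> K w -> (h m < +oo)%E ->
  (h (m + w)%R <= F + h m + T%:E)%E ->
  (h w <= F + (T + norm1 (m + w) * a (norm1 m / norm1 (m + w)))%:E)%E.
Proof.
move=> Km Kw moo mw.
have mfin : h m \is a fin_num.
  by rewrite ge0_fin_numE// (homext_ge0 P0_sub f_ge0 Km).
rewrite -(leeD2lE _ _ mfin); apply: le_trans (h_super Km Kw) _.
apply: (le_trans (leeD2r _ mw)).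
by rewrite EFinD !addeA (addeC F).
Qed.

Lemma cone_fun_restrict_min V e : 0 <= e ->
  K (((fun t => Num.min t e) \o p) |_ V).
Proof.
by move=> e0; apply: (cone_restrict_fun V (min_between e0)).
Qed.

Lemma cone_min e : 0 <= e -> K (array_min p e).
Proof.
by move=> e0; apply: (p_fun (h := fun t => Num.min t e)); apply: min_between.
Qed.

Lemma cone_excess e : 0 <= e -> K (array_excess p e).
Proof.
move=> e0; apply: (p_fun (h := fun t => Num.max (t - e) 0)) => t t0.
by rewrite le_max lexx orbT ge_max t0 andbT gerBl.
Qed.

Lemma array_min_excess e : array_min p e + array_excess p e = p.
Proof.
apply/funext => i; rewrite !fctE /array_min /array_excess.
by rewrite /Num.min /Num.max; case: ltP => ?; case: ltP => ?; lra.
Qed.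

(** For [t > eta] one has [t - eta / 2 >= t / 2 >= (eta / 2) * u t], so the restriction times
    [eta / 2] lies below the excess array. The difference is a function of [p], hence in the cone,
    and almost monotonicity transfers finiteness. *)
Lemma homext_restrict_lt_pinfty (u : R -> R) eta : 0 < eta <= 1 ->
  (forall t, 0 <= t -> 0 <= u t <= t) ->
  (h (array_excess p (eta / 2)) < +oo)%E ->
  (h ((u \o p) |_ (> eta)) < +oo)%E.
Proof.
move=> /andP[eta0 eta1] uP.
pose g t := Num.max (t - eta / 2) 0 - eta / 2 * (if eta < t then u t else 0).
have Kg : K (g \o p).
  apply: p_fun => t t0; rewrite /g; have /andP[u0 ut] := uP _ t0.
  case: ifPn => [et| _]; last first.
    by rewrite mulr0 subr0 le_max lexx orbT ge_max t0 andbT; lra.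
  rewrite max_l; last by lra.
  by apply/andP; split; nra.
have Ku : K ((u \o p) |_ (> eta)) by exact: cone_restrict_fun.
have e2 : 0 < eta / 2 by rewrite divr_gt0.
have := homext_le_add (coneZ (ltW e2) Ku) Kg.
have -> : (eta / 2) *: ((u \o p) |_ (> eta)) + (g \o p) =
    array_excess p (eta / 2).
  apply/funext => i; rewrite !fctE /restrict_levels /g /array_excess.
  by rewrite /GRing.scale/= addrC subrK.
rewrite (homextZ P0_sub f e2 Ku) => H oo.
have {}H := le_lt_trans H (lte_add_pinfty oo (ltry _)).
rewrite ltey; apply: contraTneq H => ->.
by rewrite gt0_muley ?lte_fin.
Qed.

Lemma restrict_le V x : K x -> (forall i, 0 <= (x |_ V) i <= x i).
Proof.
move=> Kx i; have x0 := cone_ge0 P0_sub i Kx.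
by rewrite /restrict_levels; case: ifP => _; rewrite x0 lexx.
Qed.

(** The exchange for [p] restricted to [V], followed by cancellation of the part of [array_min p e]
    on [V], which has a finite value even if [f p] is infinite. *)
Lemma excess_bound_above_level q (e eta : R) : P0 q ->
  norm1 ((p - q)^\+) <= e -> e <= 1 -> 0 < eta -> eta < e ->
  (h (array_excess p (eta / 2)) < +oo)%E ->
  0 < norm1 (p |_ (> eta)) -> 0 < norm1 (p |_ (predC (> eta))) ->
  (h (array_excess p e) <= f q +
    ((1 + norm1 ((p - q)^\+ |_ (> eta))) *
       (a (norm1 (p |_ (> eta)) / (1 + norm1 ((p - q)^\+ |_ (> eta)))) +
        b (1 / (1 + norm1 ((p - q)^\+ |_ (> eta)))))
     + flatten_half a e
     + norm1 (p |_ (> eta)) *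
         a ((norm1 (p |_ (> eta)) - norm1 (array_excess p e)) /
            norm1 (p |_ (> eta))))%:E)%E.
Proof.
move=> Pq xe e1 eta0 etae oo; pose V : pred R := (> eta); rewrite -/V => V0 VC0.
have VCC0 : 0 < norm1 (p |_ (predC (predC V))).
  suff -> : p |_ (predC (predC V)) = p |_ V by [].
  by apply/funext => i; rewrite /restrict_levels/= negbK.
have e0 : 0 < e by apply: lt_trans etae.
have eta01 : 0 < eta <= 1 by apply/andP; split; lra.
have [Kx Kz] := cone_posneg Pq.
have xp i := funrpos_sub_le i Pq.
have zE : q + (p - q)^\+ = p + (p - q)^\-.
  apply/funext => i; rewrite !fctE /funrpos /funrneg.
  by rewrite /Num.max; case: ltP => ?; case: ltP => ?; lra.
move: Kx Kz xp xe zE; set x := (p - q)^\+; set z := (p - q)^\-.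
move=> Kx Kz xp xe zE.
have uP := min_between (ltW e0).
have KxV : K (x |_ V).
  by apply: (cone_restrict V0 VC0 Kx) => i _.
have KyV : K ((fun i => Num.min (p i) e - x i) |_ V).
  apply: (cone_restrict_sub V0 VC0 uP Kx).
  move=> i _; rewrite le_min xp (le_trans _ xe)//.
  by apply: le_norm1; exact: summable_cone.
have Kr : K ((fun i => p i - x i) |_ (predC V)).
  apply: (cone_restrict_sub VC0 VCC0
    (u := idfun) _ Kx) => // t t0.
  by rewrite /= t0 lexx.
have KpV : K (p |_ V).
  by apply: (@cone_restrict_fun _ idfun) => t t0; rewrite t0 lexx.
have KmV := cone_fun_restrict_min V (ltW e0).
have Kexc := cone_excess (ltW e0).
have mVE : x |_ V + (fun i => Num.min (p i) e - x i) |_ V =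
    ((fun t => Num.min t e) \o p) |_ V.
  apply/funext => i; rewrite !fctE /restrict_levels.
  by case: ifP => _; rewrite ?addr0// subrKC.
(* The excess vanishes off [V] because [eta < e]. *)
have pVE : ((fun t => Num.min t e) \o p) |_ V + array_excess p e = p |_ V.
  apply/funext => i; rewrite !fctE /restrict_levels /array_excess /V /=.
  rewrite /Num.min /Num.max; case: (ltP eta (p i)) => ?; case: ifPn => ?;
    rewrite ?addr0 ?add0r; try case: ifPn; rewrite -?leNgt; lra.
(* The balance [p + z = q + x] with [x] removed from both sides off [V]. *)
have wzE : p |_ V + ((fun i => p i - x i) |_ (predC V) + z) = q + x |_ V.
  apply/funext => i; have := congr1 (fun g : array R n => g i) zE.
  rewrite !fctE /restrict_levels/=; case: (V (p i)) => /=; lra.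
have xVe : norm1 (x |_ V) <= e.
  apply: le_trans xe; apply: norm1_le (summable_cone Kx) _.
  exact: restrict_le.
have mV1 : norm1 (((fun t => Num.min t e) \o p) |_ V) <= 1.
  rewrite -(norm1_distribution P0_sub P0p); apply: norm1_le => // i.
  rewrite (cone_ge0 P0_sub i KmV)/= /restrict_levels; case: ifP => //= _.
  by rewrite ge_min lexx.
have Kw := coneD P0_sub P0_convex Kr Kz.
have := homext_exchange Pq KxV KyV KpV Kw wzE xVe.
rewrite mVE => /(_ mV1); rewrite -{1}pVE.
have moo := homext_restrict_lt_pinfty eta01 uP oo.
move=> /(homext_cancel KmV Kexc moo); rewrite pVE.
have -> : norm1 (p |_ V) - norm1 (array_excess p e) =
    norm1 (((fun t => Num.min t e) \o p) |_ V).
  by rewrite -pVE norm1D ?addrK//; exact: summable_cone.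
by [].
Qed.

Lemma le_defect_D d e : 0 <= d -> d <= e -> e <= 1 ->
  (1 + d) * (a (1 / (1 + d)) + b (1 / (1 + d))) <= D_ a b e.
Proof. by move=> d0 de e1; rewrite /D_ !mulrDr lerD// defect_inv_le. Qed.

(** The exchange with [w = p] and [y] the complement of [x] in [array_min p e], given by
    [cone_min_sub]. *)
Lemma homext_exchange_min q e : P0 q -> norm1 ((p - q)^\+) <= e ->
  0 <= e -> e <= 1 ->
  (f p <= f q + h (array_min p e) + (D_ a b e + flatten_half a e)%:E)%E.
Proof.
move=> Pq xe e0 e1; have [Kx Kz] := cone_posneg Pq.
have Ky := cone_min_sub Pq e0 xe.
have xyE : (p - q)^\+ + (array_min p e - (p - q)^\+) = array_min p e.
  by rewrite addrC subrK.
have m1 : norm1 (array_min p e) <= 1.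
  rewrite -(norm1_distribution P0_sub P0p); apply: norm1_le => // i.
  by rewrite (cone_ge0 P0_sub i (cone_min e0)) ge_min lexx.
have zE : p + (p - q)^\- = q + (p - q)^\+.
  apply/funext => i; rewrite !fctE /funrpos /funrneg.
  by rewrite /Num.max; case: ltP => ?; case: ltP => ?; lra.
have := homext_exchange Pq Kx Ky (cone_distribution P0p) Kz zE xe.
rewrite xyE => /(_ m1).
rewrite (homext_distribution P0_sub f P0p) (norm1_distribution P0_sub P0p).
move=> H; apply: (le_trans H); rewrite leeD2l// lee_fin lerD2r le_defect_D//.
by apply: norm1_ge0; case: (summable_cone Kx).
Qed.

Lemma norm1_min_excess e : 0 <= e ->
  norm1 (array_min p e) = 1 - norm1 (array_excess p e).
Proof.
move=> e0; rewrite -(norm1_distribution P0_sub P0p) -{2}(array_min_excess e).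
rewrite norm1D ?addrK//; apply: summable_cone; [exact: cone_min|].
exact: cone_excess.
Qed.

Lemma homext_min_lt_pinfty e : 0 <= e -> (f p < +oo)%E ->
  (h (array_min p e) < +oo)%E.
Proof.
move=> e0 fpoo; have := homext_le_add (cone_min e0) (cone_excess e0).
rewrite array_min_excess (homext_distribution P0_sub f P0p) => /le_lt_trans.
by apply; apply: lte_add_pinfty => //; apply: ltry.
Qed.

(** Write [p] on the left as [array_min p e + array_excess p e] and cancel the first summand; its
    norm is the argument of the last defect. *)
Lemma excess_bound_finite q e : P0 q -> norm1 ((p - q)^\+) <= e ->
  0 <= e -> e <= 1 -> (f p < +oo)%E ->
  (h (array_excess p e) <= f q +
    (D_ a b e + flatten_half a e + a (1 - norm1 (array_excess p e)))%:E)%E.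
Proof.
move=> Pq xe e0 e1 fpoo; have := homext_exchange_min Pq xe e0 e1.
rewrite -(homext_distribution P0_sub f P0p) -{1}(array_min_excess e).
move=> /(homext_cancel (cone_min e0) (cone_excess e0)).
rewrite array_min_excess (norm1_distribution P0_sub P0p) mul1r divr1.
rewrite norm1_min_excess//; apply; exact: homext_min_lt_pinfty.
Qed.

Lemma excess_bound_infinite q e : P0 q -> norm1 ((p - q)^\+) <= e ->
  0 < e -> e <= 1 -> f p = +oo%E ->
  (forall e, 0 < e <= 1 -> (h (array_excess p e) < +oo)%E) ->
  (h (array_excess p e) <= f q +
    (D_ a b e + flatten_half a e + a (1 - norm1 (array_excess p e)))%:E)%E.
Proof.
move=> Pq xe e0 e1 fpoo excoo.
have [->|fqfin] := eqVneq (f q) +oo%E; first by rewrite addye ?leey.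
have {}fqfin : f q \is a fin_num by rewrite ge0_fin_numE ?f_ge0// ltey.
have [Kx _] := cone_posneg Pq.
have Kexc := cone_excess (ltW e0).
have [eta etaP] : {eta : R^nat & forall k, [/\ 0 < eta k, eta k < e &
    1 - k.+1%:R^-1 < norm1 (p |_ (> eta k))]}.
  apply: (@choice _ _ (fun k eta => [/\ 0 < eta, eta < e &
    1 - k.+1%:R^-1 < norm1 (p |_ (> eta))])) => k.
  by apply: exists_level_mass => //; rewrite invr_gt0.
set x := (p - q)^\+ in xe Kx *.
pose P k := norm1 (p |_ (> eta k)); pose d k := norm1 (x |_ (> eta k)).
set r := norm1 (array_excess p e).
have KV V : K (p |_ V).
  by apply: (@cone_restrict_fun _ idfun) => t t0; rewrite t0 lexx.
have splitE V y : y |_ V + y |_ (predC V) = y.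
  apply/funext => i; rewrite !fctE /restrict_levels/=.
  by case: (V (p i)); rewrite ?addr0 ?add0r.
have P0k k : 0 < P k.
  have [_ _] := etaP k; apply: le_lt_trans.
  by rewrite subr_ge0 invf_le1// ler1n.
have PC k : norm1 (p |_ (predC (> eta k))) = 1 - P k.
  have := congr1 (@norm1 R n) (splitE (> eta k) p).
  rewrite norm1D; [|exact: summable_cone..].
  by rewrite (norm1_distribution P0_sub P0p) /P; lra.
(* Otherwise [p] would equal its restriction to the levels above [eta k], whose value is finite,
   against [f p = +oo]. *)
have P1k k : 0 < norm1 (p |_ (predC (> eta k))).
  rewrite (norm1_cone_gt0 P0_sub (KV _)); apply/negP => /eqP pC0.
  have [eta0 etae _] := etaP k.
  have eta01 : 0 < eta k <= 1 by apply/andP; split; lra.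
  have : (h (p |_ (> eta k)) < +oo)%E.
    apply: (@homext_restrict_lt_pinfty idfun) => //.
      by move=> t t0; rewrite /= t0 lexx.
    by apply: excoo; apply/andP; split; lra.
  have := splitE (> eta k) p; rewrite pC0 addr0 => ->.
  by rewrite (homext_distribution P0_sub f P0p) fpoo.
have Kxk k : K (x |_ (> eta k)).
  apply: (cone_restrict (P0k k) (P1k k) Kx).
  by move=> i _; exact: (funrpos_sub_le i Pq).
have d0 k : 0 <= d k by apply: norm1_ge0; case: (summable_cone (Kxk k)).
have nx0 : 0 <= norm1 x by apply: norm1_ge0; case: (summable_cone Kx).
have dx k : d k <= norm1 x.
  by apply: norm1_le (summable_cone Kx) _; exact: restrict_le.
(* Since [x <= p], the mass of [x] lost below the cutoff is at most that of [p]. *)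
have xd k : norm1 x - (1 - P k) <= d k.
  rewrite lerBlDr -PC -[X in norm1 X <= _](splitE (> eta k) x).
  have sxC : nonneg_summable (x |_ (predC (> eta k))).
    by apply: nonneg_summable_le (summable_cone Kx) _; exact: restrict_le.
  rewrite norm1D//; last exact: summable_cone.
  rewrite lerD2l; apply: norm1_le (summable_cone (KV _)) _ => i.
  rewrite /restrict_levels; case: ifP => _; rewrite ?lexx//.
  by rewrite (cone_ge0 P0_sub i Kx) (funrpos_sub_le i Pq).
have bound k : (h (array_excess p e) <= f q +
    ((1 + d k) * (a (P k / (1 + d k)) + b (1 / (1 + d k)))
     + flatten_half a e + P k * a ((P k - r) / P k))%:E)%E.
  have [eta0 etae _] := etaP k.
  apply: excess_bound_above_level => //; last exact: P0k.
  by apply: excoo; apply/andP; split; lra.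
have Pcvg : P @ \oo --> (1 : R).
  apply: (squeeze_cvgr (f := fun k => 1 - k.+1%:R^-1) (h := fun=> 1)).
  - apply: nearW => k; have [_ _ /ltW ->] := etaP k.
    by have := P1k k; rewrite PC/=; lra.
  - rewrite -[X in _ --> X]subr0; apply: cvgB; first exact: cvg_cst.
    exact: cvg_harmonic.
  - exact: cvg_cst.
have dcvg : d @ \oo --> norm1 x.
  apply: (squeeze_cvgr (f := fun k => norm1 x - (1 - P k))
    (h := fun=> norm1 x)).
  - by apply: nearW => k; rewrite xd dx.
  - rewrite -[X in _ --> X]subr0 -[X in _ - X](subrr 1).
    by apply: cvgB; [exact: cvg_cst|apply: cvgB => //; exact: cvg_cst].
  - exact: cvg_cst.
have D1cvg : (fun k => 1 + d k) @ \oo --> 1 + norm1 x.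
  by apply: cvgD => //; exact: cvg_cst.
have Dx0 : 1 + norm1 x != 0 by rewrite gt_eqF//; lra.
have Dk0 k : 0 < 1 + d k by have := d0 k; lra.
have acvg1 : (fun k => a (P k / (1 + d k))) @ \oo --> a (1 / (1 + norm1 x)).
  apply: (defect_cvg a_adm) => [k|]; last first.
    by apply: cvgM => //; apply: cvgV.
  rewrite divr_ge0 ?(ltW (Dk0 k)) ?(ltW (P0k k))//= ler_pdivrMr// mul1r.
  by have := P1k k; have := d0 k; rewrite PC; lra.
have bcvg1 : (fun k => b (1 / (1 + d k))) @ \oo --> b (1 / (1 + norm1 x)).
  apply: (defect_cvg b_adm) => [k|]; last first.
    by apply: cvgM; [exact: cvg_cst|apply: cvgV].
  rewrite divr_ge0 ?(ltW (Dk0 k))//= ler_pdivrMr// mul1r.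
  by have := d0 k; lra.
have r0 : 0 <= r by apply: norm1_ge0; case: (summable_cone Kexc).
have rP k : r <= P k.
  apply: norm1_le (summable_cone (KV _)) _ => i; have [eta0 etae _] := etaP k.
  rewrite (cone_ge0 P0_sub i Kexc)/= /restrict_levels /array_excess.
  case: ifPn => /= [_|]; first by rewrite ge_max p_ge0 andbT; lra.
  by rewrite -leNgt => pe; rewrite ge_max lexx andbT; lra.
have acvg2 : (fun k => a ((P k - r) / P k)) @ \oo --> a (1 - r).
  apply: (defect_cvg a_adm) => [k|].
    rewrite divr_ge0 ?subr_ge0 ?(ltW (P0k k))//= ler_pdivrMr// mul1r.
    by rewrite gerBl.
  rewrite -[X in _ --> X]divr1; apply: cvgM; last exact: cvgV.
  by apply: cvgB => //; exact: cvg_cst.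
have Tcvg : (fun k => (1 + d k) * (a (P k / (1 + d k)) + b (1 / (1 + d k)))
     + flatten_half a e + P k * a ((P k - r) / P k)) @ \oo -->
     (1 + norm1 x) * (a (1 / (1 + norm1 x)) + b (1 / (1 + norm1 x)))
     + flatten_half a e + 1 * a (1 - r).
  apply: cvgD; last exact: cvgM.
  apply: cvgD; last exact: cvg_cst.
  by apply: cvgM => //; apply: cvgD.
have excfin : h (array_excess p e) \is a fin_num.
  rewrite ge0_fin_numE ?(homext_ge0 P0_sub f_ge0 Kexc)//.
  by apply: excoo; rewrite e0.
(* With both values finite, the bounds pass to the limit in the reals; [le_defect_D] then replaces
   [norm1 x] by [e]. *)
rewrite -(fineK excfin) -(fineK fqfin) -EFinD lee_fin -lerBlDl.
have : fine (h (array_excess p e)) - fine (f q) <=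
    (1 + norm1 x) * (a (1 / (1 + norm1 x)) + b (1 / (1 + norm1 x)))
     + flatten_half a e + 1 * a (1 - r).
  apply: (cvgr_to_ge Tcvg); apply: nearW => k; have := bound k.
  by rewrite -{1}(fineK excfin) -{1}(fineK fqfin) -EFinD lee_fin lerBlDl.
have := le_defect_D nx0 xe e1; rewrite mul1r; lra.
Qed.

End SemicontinuityAtP.

(** * Rearrangement in the extended reals and conclusion *)

Lemma lee_sub_of_le_add (R : realType) (x y z : \bar R) (c d : R) :
  (x < +oo)%E -> (0 <= x)%E -> (0 <= z)%E ->
  (x <= y + z + (c + d)%:E)%E -> (x - z - c%:E - d%:E <= y)%E.
Proof.
move=> xoo x0; have : x \is a fin_num by rewrite ge0_fin_numE.
move: x y z {xoo x0} => [x||] [y||] [z||] //=; rewrite ?leey ?leNye//.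
by rewrite !lee_fin => _ _; lra.
Qed.

Lemma lee_sub3_of_le_add (R : realType) (x y : \bar R) (c d e : R) :
  (x <= y + (c + d + e)%:E)%E -> (x - c%:E - d%:E - e%:E <= y)%E.
Proof.
move: x y => [x||] [y||] //=; rewrite ?leey ?leNye//.
by rewrite !lee_fin; lra.
Qed.

Theorem lemma3 (R : realType) (n : nat) (n_ge1 : (1 <= n)%N)
    (P0 : set (array R n))
    (P0_sub : P0 `<=` distributions R n)
    (P0_convex : convex_set P0)
    (a b : R -> R)
    (a_adm : admissible_defect a) (b_adm : admissible_defect b)
    (f : array R n -> \bar R)
    (f_ge0 : forall x, P0 x -> (0 <= f x)%E)
    (f_lower : forall x y l, P0 x -> P0 y -> 0 <= l <= 1 ->
      (l%:E * f x + (1 - l)%:E * f y - (a l)%:E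
         <= f (l *: x + (1 - l) *: y)%R)%E)
    (f_upper : forall x y l, P0 x -> P0 y -> 0 <= l <= 1 ->
      (f (l *: x + (1 - l) *: y)%R
         <= l%:E * f x + (1 - l)%:E * f y + (b l)%:E)%E)
    (p : array R n) (P0p : P0 p)
    (p_fun : forall h : R -> R, (forall x, 0 <= x -> 0 <= h x <= x) ->
      cone P0 (h \o p))
    (p_diff : forall q, P0 q -> q <> p ->
      cone P0 ((p - q)^\+) /\ cone P0 ((p - q)^\-)) :
  ((f p < +oo)%E ->
   forall (q : array R n) (e : R),
     P0 q -> 0 < e -> (TV p q <= e%:E)%E -> e <= 1 ->
     (f p - homext f (array_min p e) - (D_ a b e)%:E - (flatten_half a e)%:E
        <= f q)%E)
  /\
  ((f p < +oo)%E \/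
   (forall e, 0 < e <= 1 -> (homext f (array_excess p e) < +oo)%E) ->
   forall (q : array R n) (e : R),
     P0 q -> 0 < e -> (TV p q <= e%:E)%E -> e <= 1 ->
     (homext f (array_excess p e) - (D_ a b e)%:E - (flatten_half a e)%:E
        - (a (1 - norm1 (array_excess p e))%R)%:E
        <= f q)%E).
Proof.
have bound q e : P0 q -> (TV p q <= e%:E)%E -> norm1 ((p - q)^\+) <= e.
  by move=> Pq /(TV_norm1_le P0_sub P0p p_diff Pq)[].
split=> [fpoo|fin] q e Pq e0 /(bound _ _ Pq) xe e1.
  apply: lee_sub_of_le_add => //; first exact: f_ge0.
    by apply: (homext_ge0 P0_sub f_ge0); apply: (cone_min p_fun (ltW e0)).
  exact: (homext_exchange_min P0_sub P0_convex P0p p_fun p_diff a_adm b_adm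
    f_ge0 f_lower f_upper Pq xe (ltW e0) e1).
apply: lee_sub3_of_le_add.
(* Sorting by the finiteness of [f p]: if it is infinite, only the second alternative on the excess
   arrays remains. *)
have [fpoo|] := ltP (f p) +oo%E.
  exact: (excess_bound_finite P0_sub P0_convex P0p p_fun p_diff a_adm b_adm
    f_ge0 f_lower f_upper Pq xe (ltW e0) e1 fpoo).
rewrite leye_eq => /eqP fpoo; case: fin => [|excoo]; first by rewrite fpoo.
exact: (excess_bound_infinite P0_sub P0_convex P0p p_fun p_diff a_adm b_adm
  f_ge0 f_lower f_upper Pq xe e0 e1 fpoo excoo).
Qed.
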